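(* Let $N\ge 2$ be an integer and let $0<\rho<1/N$. Suppose that $\rho^{-m}=B$ for some integers $m\ge 1$ and $B\ge 2$, and that $N\nmid B$. Then the $N$-Bernoulli convolution $\mu_{\rho,N}$ admits no frame measure.
   Context: Definition of $\mu_{\rho,N}$: let $A_1,A_2,\dots$ be independent random variables, each uniformly distributed on $\{0,1,\dots,N-1\}$. Then $\mu_{\rho,N}$ is the law (a compactly supported Borel probability measure on $\mathbb{R}$) of the random variable $X_{\rho,N}=\sum_{j=1}^{\infty}A_j\rho^j$. Equivalently, it is the equal-weight self-similar probability measure generated by the maps $S_a(x)=\rho(x+a)$, $a\in\{0,1,\dots,N-1\}$. Fourier convention: for a compactly supported Borel probability measure $\nu$ on $\mathbb{R}$ and $f\in L^2(\nu)$ (complex-valued), $\widehat{f\nu}(\lambda)=\int_{\mathbb{R}} f(x)e^{-2\pi i\lambda x}\,d\nu(x)$ for $\lambda\in\mathbb{R}$. Frame measure: a positive Borel measure $\Gamma$ on $\mathbb{R}$ is a frame measure for $\nu$ if there are constants $0<A\le C<\infty$ such that $$A\|f\|_{L^2(\nu)}^2\le\int_{\mathbb{R}}|\widehat{f\nu}(\lambda)|^2\,d\Gamma(\lambda)\le C\|f\|_{L^2(\nu)}^2\quad\text{for every } f\in L^2(\nu).$$ ''$\nu$ admits a frame measure'' means that some such $\Gamma$ exists. *)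

(* Defs.v *)
From HB Require Import structures.
From mathcomp Require Import all_boot all_order all_algebra finmap.
From mathcomp Require Import complex.
From mathcomp Require Import all_classical all_reals all_analysis.

Set Implicit Arguments.
Unset Strict Implicit.
Unset Printing Implicit Defensive.

Import Order.TTheory GRing.Theory Num.Theory.
Import numFieldNormedType.Exports.

Local Open Scope classical_set_scope.
Local Open Scope ring_scope.
Local Open Scope complex_scope.

Section independence.
Context {d d' : measure_display} {T : measurableType d} {T' : measurableType d'}
  {R : realType} {P : probability T R} {I : choiceType}.

Definition mutually_independent (X : I -> {RV P >-> T'}) : Prop :=
  forall (J : {fset I}) (E : I -> set T'), (forall i, measurable (E i)) ->
    P (\bigcap_(i in [set` J]) X i @^-1` E i) =
    (\prod_(i <- J) P (X i @^-1` E i))%E.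

End independence.

Definition uniform_digit {d : measure_display} {T : measurableType d}
    {R : realType} {P : probability T R} (N : nat) (X : {RV P >-> nat}) : Prop :=
  forall k : nat, (k < N)%N -> P (X @^-1` [set k]) = (N%:R^-1)%:E.

Section bernoulli_convolution.
Context {R : realType}.

(* [mu] is the law mu_{rho,N} of X = \sum_(j >= 1) A_j rho^j.  The digits are
   indexed from 0, so that [A j] stands for A_(j+1). The measure is described
   through an arbitrary probability space carrying the digits; any two choices
   give the same law.  The convergence is almost sure because uniformity only
   forces [A j < N] almost surely. *)
Definition is_bernoulli_convolution (N : nat) (rho : R)
    (mu : probability R R) : Prop :=
  exists (d : measure_display) (T : measurableType d) (P : probability T R)
    (A : nat -> {RV P >-> nat}) (X : {RV P >-> R}),
    [/\ mutually_independent A,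
        (forall j, uniform_digit N (A j)),
        {ae P, forall w,
          series (fun j => (A j w)%:R * rho ^+ j.+1) @ \oo --> X w} &
        forall E : set R, measurable E -> mu E = distribution P X E].

End bernoulli_convolution.

Section frame_measure.
Context {R : realType}.
Implicit Types (nu : probability R R) (Gamma : {measure set R -> \bar R})
  (f : R -> R[i]).

(* The modulus as an element of [R]; the norm [`|z|] of [z : R[i]] lies in
   [R[i]] itself. *)
Local Notation normc := ComplexField.Normc.normc.

(* e^{i t} *)
Definition expi (t : R) : R[i] := cos t +i* sin t.

Definition cintegral nu f : R[i] :=
  (\int[nu]_x complex.Re (f x)) +i* (\int[nu]_x complex.Im (f x)).

Definition cmeasurable f : Prop :=
  measurable_fun [set: R] (fun x => complex.Re (f x)) /\
  measurable_fun [set: R] (fun x => complex.Im (f x)).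

Definition sqnormL2 nu f : \bar R := (\int[nu]_x (normc (f x) ^+ 2)%:E)%E.

Definition in_L2 nu f : Prop := cmeasurable f /\ (sqnormL2 nu f < +oo)%E.

Definition fourier nu f (lambda : R) : R[i] :=
  cintegral nu (fun x => f x * expi (- (2 * pi * lambda * x))).

(* No sigma-finiteness or local finiteness is imposed on [Gamma]: it is an
   arbitrary positive Borel measure. *)
Definition is_frame_measure nu Gamma : Prop :=
  exists A C : R, [/\ 0 < A, A <= C &
    forall f, in_L2 nu f ->
      (A%:E * sqnormL2 nu f
         <= \int[Gamma]_lambda (normc (fourier nu f lambda) ^+ 2)%:E
         <= C%:E * sqnormL2 nu f)%E].

Definition admits_frame_measure nu : Prop :=
  exists Gamma : {measure set R -> \bar R}, is_frame_measure nu Gamma.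

End frame_measure.

(* Main.v *)
(* Let [g = gcd(N, B)], [N = g n], [B = g b], so that [n >= 2] is coprime to
   [b], and let [M] be the modulus of the mask [(1 + z + .. + z^(n-1)) / n] at
   [z = e^(iu)].  A digit in position J can be written as [d + n e] and a digit
   in position J + m as [e' + g d'], with [d], [d'] uniform on {0,..,n-1}.
   Since [rho^m = 1/B], the masks of [d'] and [d] are then [M(u)] and [M(b u)]
   for the same [u].  Coprimality gives [M(b u) <= L * M(u)]: every zero of the
   first mask is a zero of the second.

   Start from the indicator [f] of a set given by finitely many digits and
   restrict it further to [d' = 0].  This divides the squared norm by [n] and
   divides the transform by [n M(u)].  As J goes to infinity, the finite measure
   [|hat f|^2 dGamma] sees only [u] near 0, where [M(u)] is about 1, and the
   region where [M(u)] is small contributes nothing because [M(b u)] is small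
   there too.  Hence the frame integral gets divided by almost [n^2], and its
   quotient by the squared norm decreases by a factor at most 3/4.  Iterating
   contradicts the lower frame bound. *)
Require Import Defs.
From mathcomp Require Import all_boot all_order all_algebra finmap complex.
From mathcomp Require Import all_classical all_reals all_analysis.
From mathcomp Require Import measurable_realfun.
From mathcomp Require Import ring lra.

Set Implicit Arguments.
Unset Strict Implicit.
Unset Printing Implicit Defensive.

Import Order.TTheory GRing.Theory Num.Theory.
Import numFieldNormedType.Exports.

Local Open Scope classical_set_scope.
Local Open Scope ring_scope.
Local Open Scope complex_scope.

Local Notation normc := ComplexField.Normc.normc.

(** * Masks *)

Section geometric_polynomial.
Context {A : comNzRingType}.
Implicit Types (z : A) (a b n : nat).

Definition geo n z : A := \sum_(i < n) z ^+ i.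

(** Division of the exponent by [b] with remainder: a uniform digit below [a * b] splits into
    independent uniform digits below [a] and below [b]. *)
Lemma geoM a b z : geo (a * b) z = geo a (z ^+ b) * geo b z.
Proof.
elim: a => [|a IHa]; first by rewrite /geo !big_ord0 mul0r.
have -> : geo a.+1 (z ^+ b) = geo a (z ^+ b) + (z ^+ b) ^+ a.
  by rewrite /geo big_ord_recr.
rewrite mulrDl -IHa mulSn addnC /geo big_split_ord /= mulr_sumr.
by congr (_ + _); apply: eq_bigr => i _; rewrite exprD mulnC exprM.
Qed.

Lemma geoS n z : geo n.+1 z = 1 + z * geo n z.
Proof.
rewrite /geo big_ord_recl expr0 mulr_sumr; congr (_ + _).
by apply: eq_bigr => i _; rewrite -exprS.
Qed.

(* With [k * b = l * n + 1] both sides of [geo n (z ^+ b) * geo b z =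
   geo b (z ^+ n) * geo n z] combine with the Bezout relation
   [1 = geo k (z ^+ b) * geo b z - z * geo l (z ^+ n) * geo n z]. *)
Lemma geo_bezout n b k l z : (k * b = (l * n).+1)%N ->
  geo n (z ^+ b) = geo n z *
    (geo b (z ^+ n) * geo k (z ^+ b) - z * geo l (z ^+ n) * geo n (z ^+ b)).
Proof.
move=> kbln.
have bez : geo k (z ^+ b) * geo b z = 1 + z * (geo l (z ^+ n) * geo n z).
  by rewrite -!geoM kbln geoS.
have sw : geo n (z ^+ b) * geo b z = geo b (z ^+ n) * geo n z.
  by rewrite -!geoM mulnC.
transitivity (geo n (z ^+ b) *
    (geo k (z ^+ b) * geo b z - z * (geo l (z ^+ n) * geo n z))).
  by rewrite bez; ring.
transitivity (geo k (z ^+ b) * (geo n (z ^+ b) * geo b z)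
   - geo n (z ^+ b) * z * (geo l (z ^+ n) * geo n z)); first by ring.
by rewrite sw; ring.
Qed.

End geometric_polynomial.

Section circle.
Context {R : realType}.
Implicit Types (s t : R) (z : R[i]).

Lemma expiD s t : expi (s + t) = expi s * expi t.
Proof. by rewrite /expi cosD sinD; simpc; rewrite [sin s * _ + _]addrC. Qed.

Lemma expi0 : expi (0 : R) = 1.
Proof. by rewrite /expi cos0 sin0. Qed.

Lemma expiMn t n : expi (t *+ n) = expi t ^+ n.
Proof.
elim: n => [|n IHn]; first by rewrite mulr0n expi0 expr0.
by rewrite mulrS expiD IHn exprS.
Qed.

Lemma normc_expi t : normc (expi t) = 1.
Proof. by rewrite /= cos2Dsin2 sqrtr1. Qed.

Lemma normcX z n : normc (z ^+ n) = normc z ^+ n.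
Proof.
elim: n => [|n IHn]; first by rewrite !expr0 ComplexField.Normc.normc1.
by rewrite !exprS ComplexField.Normc.normcM IHn.
Qed.

Lemma normc_ge0 z : 0 <= normc z.
Proof. by case: z => x y; exact: sqrtr_ge0. Qed.

Lemma sqr_normcE z : normc z ^+ 2 = complex.Re z ^+ 2 + complex.Im z ^+ 2.
Proof. by case: z => x y /=; rewrite sqr_sqrtr // addr_ge0 ?sqr_ge0. Qed.

Lemma normc_real (x : R) : normc x%:C = `|x|.
Proof. by rewrite /= expr0n addr0 sqrtr_sqr. Qed.

Lemma le_normc_geo n z : normc z = 1 -> normc (geo n z) <= n%:R.
Proof.
move=> z1; elim: n => [|n IHn].
  by rewrite /geo big_ord0 ComplexField.Normc.normc0.
rewrite /geo big_ord_recr /=; apply: (le_trans (le_normcD _ _)).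
by rewrite normcX z1 expr1n -natr1 lerD2r.
Qed.

(** For coprime [n] and [b] the polynomial [geo n z] divides [geo n (z ^+ b)], and the explicit
    cofactor of [geo_bezout] is bounded on the unit circle. *)
Lemma coprime_geo_bound n b : (0 < b)%N -> coprime n b ->
  exists2 L : R, 0 < L & forall z, normc z = 1 ->
    normc (geo n (z ^+ b)) <= L * normc (geo n z).
Proof.
move=> b0; rewrite coprime_sym => cnb.
have [k l kbln _] := egcdnP n b0.
rewrite (eqP cnb) addn1 in kbln.
(* [b k] and [l n] bound the two products in the cofactor; the added 1 makes positivity
   immediate. *)
exists (b%:R * k%:R + l%:R * n%:R + 1) => [|z z1].
  by rewrite ltr_wpDl// addr_ge0// mulr_ge0.
have zX i : normc (z ^+ i) = 1 by rewrite normcX z1 expr1n.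
rewrite (geo_bezout z kbln) ComplexField.Normc.normcM mulrC.
apply: ler_wpM2r; first exact: normc_ge0.
apply: (le_trans (le_normcD _ _)); rewrite normcN.
rewrite -[leLHS]addr0; apply: lerD => //.
apply: lerD; rewrite !ComplexField.Normc.normcM ?z1 ?mul1r;
  apply: ler_pM; rewrite ?normc_ge0 ?le_normc_geo//.
Qed.

End circle.

Section masks.
Context {R : realType}.
Variable N : nat.
Implicit Types (D : pred nat) (t : R).

(** The factor is [1/N] for every [D]: this is the transform of the uniform digit law restricted to
    [D], not conditioned on it. *)
Definition digit_mask D t : R[i] :=
  (N%:R^-1)%:C * \sum_(a < N | D a) expi t ^+ a.

(** With the digit written as [e + g d], [e < g], the condition [a < g] says [d = 0]; the mask of
    [d] is read at the angle [g t]. *)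
Lemma digit_mask_lt g n t : N = (g * n)%N -> (0 < n)%N ->
  digit_mask predT t = (n%:R)%:C * ((n%:R^-1)%:C * geo n (expi t ^+ g)) *
    digit_mask (fun a => (a < g)%N) t.
Proof.
move=> Ngn n0; rewrite /digit_mask [_%:C * (_ * geo _ _)]mulrA -rmorphM /=.
rewrite mulfV ?pnatr_eq0 -?lt0n// mul1r.
rewrite [RHS]mulrCA; congr (_ * _).
rewrite -[LHS]/(geo N (expi t)) Ngn mulnC geoM; congr (_ * _).
rewrite /geo -(big_ord_widen (n * g) (fun a => expi t ^+ a))//.
by rewrite leq_pmull.
Qed.

(** Here the digit is [d + n e] with [d < n], and divisibility by [n] says [d = 0]. *)
Lemma digit_mask_dvd g n t : N = (g * n)%N -> (0 < n)%N ->
  digit_mask predT t = (n%:R)%:C * ((n%:R^-1)%:C * geo n (expi t)) *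
    digit_mask (fun a => n %| a)%N t.
Proof.
move=> Ngn n0; rewrite /digit_mask [_%:C * (_ * geo _ _)]mulrA -rmorphM /=.
rewrite mulfV ?pnatr_eq0 -?lt0n// mul1r.
rewrite [RHS]mulrCA; congr (_ * _).
rewrite -[LHS]/(geo N (expi t)) Ngn geoM mulrC; congr (_ * _).
rewrite /geo -(big_mkord (fun a => n %| a)%N (fun a => expi t ^+ a)) /=.
(* In each block of [n] integers starting at [h * n], only the left end is a multiple of [n]. *)
elim: (g) => [|h IHh]; first by rewrite big_ord0 mul0n big_geq.
rewrite big_ord_recr /= IHh mulSn addnC.
rewrite [in RHS](@big_cat_nat _ _ _ (h * n)) ?leq_addr//=; congr (_ + _).
rewrite big_ltn_cond; last by rewrite -[ltnLHS]addn0 ltn_add2l.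
rewrite dvdn_mull// big_nat_cond big1 ?addr0; first by rewrite mulnC exprM.
move=> i /andP[/andP[hi ih]]; rewrite -(subnKC (ltnW hi)) dvdn_addr ?dvdn_mull//.
move/dvdn_leq; rewrite subn_gt0 hi => /(_ isT).
by rewrite leqNgt ltn_subLR ?ih// ltnW.
Qed.

End masks.

(** * Digit expansions *)

Section digits.
Context {R : realType}.
Variable rho : R.
Implicit Types (x : R) (a : nat -> nat) (D : nat -> pred nat).

(** If [x = rho (a + y)] with [a] a natural number and [0 <= y < 1], then [digit] recovers [a] and
    [digit_shift] recovers [y]. *)
Definition digit x : nat := Num.truncn (x / rho).

Definition digit_shift x : R := x / rho - (digit x)%:R.

(** The digit conditions are imposed on real numbers, not on sample points, so that the indicator is
    a test function in [L^2(mu)]. *)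
Definition digit_set D : set R :=
  [set x | forall k, D k (digit (iter k digit_shift x))].

Definition digit_term a : R^nat := fun j => (a j)%:R * rho ^+ j.+1.

Lemma series_digit_recl a n : series (digit_term a) n.+1 =
  rho * ((a 0%N)%:R + series (digit_term (a \o succn)) n).
Proof.
rewrite !seriesEord /= big_ord_recl /digit_term /= expr1 mulrDr mulr_sumr.
rewrite mulrC; congr (_ + _); apply: eq_bigr => i _.
by rewrite /bump /= [in RHS]mulrCA -exprS.
Qed.

Section recovery.
Variable N : nat.
Hypotheses (N0 : (0 < N)%N) (hrho : 0 < rho < N%:R^-1).

(** The sum of [(N - 1) rho^j] over [j >= 1], the largest value of an expansion; it is below 1
    because [N rho < 1]. *)
Let bound : R := (N.-1)%:R * rho / (1 - rho).

Let Nrho : N%:R * rho < 1.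
Proof. by case/andP: hrho => r0 rN; rewrite mulrC -ltr_pdivlMr ?ltr0n// div1r. Qed.

Let NE : N%:R = (N.-1)%:R + 1 :> R.
Proof. by rewrite natr1 prednK. Qed.

Let rho1 : rho < 1.
Proof.
have := Nrho; rewrite NE mulrDl mul1r; apply: le_lt_trans.
by rewrite lerDr; apply: mulr_ge0 => //; case/andP: hrho => /ltW.
Qed.

Let bound_lt1 : bound < 1.
Proof.
rewrite /bound ltr_pdivrMr ?subr_gt0// mul1r ltrBrDr.
by have := Nrho; rewrite NE mulrDl mul1r.
Qed.

Lemma series_digit_ge0 a n : 0 <= series (digit_term a) n.
Proof.
rewrite seriesEord /=; apply: sumr_ge0 => i _; apply: mulr_ge0 => //.
by apply: exprn_ge0; case/andP: hrho => /ltW.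
Qed.

Let series_digit_le a n : (forall j, (a j < N)%N) ->
  series (digit_term a) n <= bound.
Proof.
have b0 : 0 <= bound.
  rewrite /bound; apply: divr_ge0; last by rewrite subr_ge0 ltW.
  apply: mulr_ge0 => //.
  by case/andP: hrho => /ltW.
have r0 : 0 < rho by case/andP: hrho.
(* [bound] is the fixed point of [x -> rho (N - 1 + x)], which matches the recursion of
   [series_digit_recl]. *)
have bE : bound = rho * ((N.-1)%:R + bound).
  have : bound * (1 - rho) = (N.-1)%:R * rho.
    by rewrite /bound divfK// subr_eq0 gt_eqF.
  rewrite mulrBr mulr1 => /eqP; rewrite subr_eq => /eqP {1}->.
  by rewrite mulrDr mulrC [bound * _]mulrC.
elim: n a => [|n IHn] a aN; first by rewrite seriesEord /= big_ord0.
rewrite series_digit_recl bE ler_pM2l// lerD//; last by apply: IHn => j; exact: aN.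
by rewrite ler_nat -ltnS prednK.
Qed.

(** The shifted series has its sum in [[0, bound]], inside [[0, 1)], so truncation cannot misread
    the first digit. *)
Lemma digit_shift_series a x : (forall j, (a j < N)%N) ->
  series (digit_term a) @ \oo --> x ->
  digit x = a 0%N /\ series (digit_term (a \o succn)) @ \oo --> digit_shift x.
Proof.
move=> aN ax; have r0 : 0 < rho by case/andP: hrho.
set b := a \o succn.
have bx : series (digit_term b) @ \oo --> x / rho - (a 0%N)%:R.
  rewrite (_ : series (digit_term b) =
      fun n => series (digit_term a) n.+1 / rho - (a 0%N)%:R).
    apply: cvgB; last exact: cvg_cst.
    by apply: cvgMl; move: ax; rewrite -[X in X -> _]cvg_shiftS.
  apply/funext => n; rewrite series_digit_recl mulrC mulKf ?gt_eqF//.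
  by rewrite addrAC subrr add0r.
have y0 : 0 <= x / rho - (a 0%N)%:R.
  by apply: (cvgr_to_ge bx); near=> n; exact: series_digit_ge0.
have y1 : x / rho - (a 0%N)%:R <= bound.
  by apply: (cvgr_to_le bx); near=> n; apply: series_digit_le => j; exact: aN.
have dx : digit x = a 0%N.
  rewrite /digit; apply: truncn_def; rewrite -subr_ge0 y0 /=.
  by rewrite -natr1 -ltrBlDl (le_lt_trans y1).
by split=> //; rewrite /digit_shift dx.
Unshelve. all: by end_near. Qed.

Lemma digit_iter_series a x k : (forall j, (a j < N)%N) ->
  series (digit_term a) @ \oo --> x -> digit (iter k digit_shift x) = a k.
Proof.
elim: k a x => [|k IHk] a x aN ax; first by case: (digit_shift_series aN ax).
have [_ bx] := digit_shift_series aN ax.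
by rewrite iterSr (IHk _ _ _ bx)// => j; exact: aN.
Qed.

End recovery.

Lemma measurable_digit_nat : 0 < rho ->
  measurable_fun [set: R] (fun x => (digit x)%:R : R).
Proof.
move=> r0; apply: nondecreasing_measurable => // x y xy.
by rewrite ler_nat le_truncn// ler_wpM2r// invr_ge0 ltW.
Qed.

Lemma measurable_digit_shift : 0 < rho -> measurable_fun [set: R] digit_shift.
Proof.
move=> r0; apply: measurable_funB; last exact: measurable_digit_nat.
by apply: measurable_funM.
Qed.

Lemma measurable_digit_set D : 0 < rho -> measurable (digit_set D).
Proof.
move=> r0.
have mshift k : measurable_fun [set: R] (iter k digit_shift).
  elim: k => [|k IHk]; first exact: measurable_id.
  exact: measurableT_comp (measurable_digit_shift r0) IHk.
have -> : digit_set D = \bigcap_k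
    ((fun x => (digit (iter k digit_shift x))%:R : R) @^-1`
     \bigcup_(i in [set i | D k i]) [set i%:R : R]).
  apply/seteqP; split => x /= xD k.
    by move=> _; exists (digit (iter k digit_shift x)) => //; exact: xD.
  by have [i Di /= /eqP] := xD k I; rewrite eqr_nat => /eqP ->.
apply: bigcap_measurable => // k _; rewrite -[X in measurable X]setTI.
apply: (measurableT_comp (measurable_digit_nat r0) (mshift k)) => //.
by apply: bigcup_measurable => i _; exact: measurable_set1.
Qed.

End digits.

(** * Fourier transforms of digit-restricted measures *)

Lemma probability_bounded_integrable {d} {T : measurableType d} {R : realType}
    (P : probability T R) (f : T -> R) (C : R) :
  measurable_fun [set: T] f -> (forall x, `|f x| <= C) ->
  P.-integrable [set: T] (EFin \o f).
Proof.
move=> mf fC; apply: measurable_bounded_integrable => //.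
  by rewrite (le_lt_trans (probability_le1 _ _)) ?ltry.
exists C; split; first exact: num_real.
by move=> M CM x _ /=; exact: le_trans (fC x) (ltW CM).
Qed.

Section digit_law.
Context {R : realType} {d : measure_display} {T : measurableType d}
  {P : probability T R}.
Variables (N : nat) (A : nat -> {RV P >-> nat}).
Hypotheses (N0 : (0 < N)%N) (indA : mutually_independent A)
  (unifA : forall j, uniform_digit N (A j)).

Definition digit_cylinder n (v : {ffun 'I_n -> 'I_N}) : set T :=
  \bigcap_(k in [set: 'I_n]) A k @^-1` [set (v k : nat)].

Let measurable_digit_preimage k (Y : set nat) : measurable (A k @^-1` Y).
Proof. by rewrite -[X in measurable X]setTI; exact: measurable_funPT. Qed.

Lemma measurable_digit_cylinder n (v : {ffun 'I_n -> 'I_N}) :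
  measurable (digit_cylinder v).
Proof. by apply: fin_bigcap_measurable => // k _. Qed.

Lemma digit_cylinderE n (v : {ffun 'I_n -> 'I_N}) :
  P (digit_cylinder v) = (N%:R^-1 ^+ n)%:E.
Proof.
(* [mutually_independent] takes a finite set of naturals and an event for every natural, hence the
   default [setT] at indices from [n] on. *)
pose J : {fset nat} := [fset (val i : nat) | i in 'I_n]%fset.
pose E k : set nat := if insub k is Some i then [set (v i : nat)] else setT.
have -> : digit_cylinder v = \bigcap_(k in [set` J]) A k @^-1` E k.
  apply/seteqP; split => w /= Aw.
    move=> k /imfsetP[i _ ->] /=; rewrite /E valK; exact: Aw.
  move=> i _; have /= := Aw (val i).
  by rewrite /E valK; apply; apply/imfsetP; exists i.
rewrite indA//; rewrite (eq_big_seq (fun=> (N%:R^-1)%:E)).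
  rewrite big_const_seq count_predT -/(#|` J|).
  rewrite card_imfset /=; last exact: val_inj.
  rewrite -cardE card_ord; elim: n {v J E} => [|n IHn]; first by rewrite expr0.
  by rewrite iterS IHn exprS EFinM.
by move=> k /imfsetP[i _ ->] /=; rewrite /E valK unifA.
Qed.

(** The [N] prescribed values already carry total mass 1, and a countable union of null sets is
    null. *)
Lemma digit_lt_ae : {ae P, forall w, forall j, (A j w < N)%N}.
Proof.
have null j : P (~` (A j @^-1` [set a | (a < N)%N])) = 0.
  rewrite probability_setC; last exact: measurable_digit_preimage.
  have -> : A j @^-1` [set a | (a < N)%N] =
      \big[setU/set0]_(a < N) (A j @^-1` [set (a : nat)]).
    rewrite -(bigcup_mkord N (fun a => A j @^-1` [set a])).
    apply/seteqP; split => w /=; first by move=> wN; exists (A j w).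
    by move=> [a /= aN ->].
  rewrite (measure_bigsetU _ (F := fun a => A j @^-1` [set a]))//=; last first.
    apply/trivIsetP => a b _ _ /eqP ab; apply/seteqP; split => // w /= [-> ba].
    exact: ab.
  rewrite (eq_bigr (fun=> (N%:R^-1)%:E)); last by move=> a _; rewrite unifA.
  rewrite sumEFin sumr_const card_ord -[_ *+ _]mulr_natl mulfV ?pnatr_eq0 -?lt0n//.
  by rewrite subee.
apply/ae_foralln => j; exists (~` (A j @^-1` [set a | (a < N)%N])).
split; [apply: measurableC; exact: measurable_digit_preimage|exact: null|by []].
Qed.

(** A function of the first [n] digits as a combination of cylinder indicators; it vanishes wherever
    one of these digits is [N] or more. *)
Definition digit_simple n (F : {ffun 'I_n -> 'I_N} -> R) (w : T) : R :=
  \sum_v F v * \1_(digit_cylinder v) w.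

Lemma measurable_digit_simple n (F : {ffun 'I_n -> 'I_N} -> R) :
  measurable_fun [set: T] (digit_simple F).
Proof.
apply: measurable_sum => v; apply: measurable_funM => //.
by apply: measurable_indic; exact: measurable_digit_cylinder.
Qed.

Lemma digit_simpleE n (F : {ffun 'I_n -> 'I_N} -> R) w
    (wN : forall j, (A j w < N)%N) :
  digit_simple F w = F [ffun i : 'I_n => Ordinal (wN i)].
Proof.
rewrite /digit_simple (bigD1 [ffun i : 'I_n => Ordinal (wN i)])//= indicE mem_set.
  rewrite mulr1 big1 ?addr0// => v /eqP vA; rewrite indicE memNset ?mulr0//.
  move=> wv; apply: vA; apply/ffunP => i; rewrite ffunE; apply: val_inj => /=.
  by rewrite -(wv i).
by move=> i _ /=; rewrite ffunE.
Qed.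

Lemma integral_digit_simple n (F : {ffun 'I_n -> 'I_N} -> R) :
  (\int[P]_w (digit_simple F w)%:E)%E = (N%:R^-1 ^+ n * \sum_v F v)%:E.
Proof.
under eq_integral do rewrite /digit_simple -sumEFin.
rewrite integral_sum//; last first.
  move=> v; apply: (@probability_bounded_integrable _ _ _ _ _ `|F v|) => [|w].
    apply: measurable_funM => //.
    by apply: measurable_indic; exact: measurable_digit_cylinder.
  by rewrite normrM ler_piMr// indicE; case: (_ \in _); rewrite ?normr1 ?normr0.
rewrite mulr_sumr -sumEFin; apply: eq_bigr => v _.
under eq_integral do rewrite EFinM.
rewrite integralZl//; last first.
  apply: (@probability_bounded_integrable _ _ _ _ _ 1) => [|w].
    by apply: measurable_indic; exact: measurable_digit_cylinder.
  by rewrite indicE; case: (_ \in _); rewrite ?normr1 ?normr0.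
rewrite integral_indic//; last exact: measurable_digit_cylinder.
rewrite setIT (_ : _ (digit_cylinder v) = (N%:R^-1 ^+ n)%:E).
  by rewrite -EFinM mulrC.
exact: digit_cylinderE.
Qed.

End digit_law.

Section partial_products.
Context {R : realType}.
Variables (N : nat) (rho : R).
Implicit Types (D : nat -> pred nat) (lambda : R).

Definition partial_fourier D n lambda : R[i] :=
  \prod_(k < n) digit_mask N (D k) (- (2 * pi * lambda * rho ^+ k.+1)).

Definition digit_sum n (v : {ffun 'I_n -> 'I_N}) : R :=
  \sum_(i < n) (v i)%:R * rho ^+ i.+1.

(** The expectation of [phi] at the [n]-th partial sum, over the event that the first [n] digits
    satisfy [D]. *)
Definition digit_average D n (phi : R -> R) : R :=
  N%:R^-1 ^+ n * \sum_(v : {ffun 'I_n -> 'I_N})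
    if [forall i : 'I_n, D i (v i)] then phi (digit_sum v) else 0.

Lemma sum_Complex (I : finType) (x y : I -> R) :
  \sum_i (x i +i* y i) = (\sum_i x i) +i* (\sum_i y i).
Proof.
by elim/big_ind3 : _ => // a1 b1 z1 a2 b2 z2 -> ->.
Qed.

(** Distributing the product of sums over all digit tuples turns it into an average of exponentials;
    failed conditions give zero factors. *)
Lemma partial_fourierE D n lambda : partial_fourier D n lambda =
  digit_average D n (fun x => cos (- (2 * pi * lambda * x))) +i*
  digit_average D n (fun x => sin (- (2 * pi * lambda * x))).
Proof.
rewrite /partial_fourier /digit_mask big_split /= big_const_ord.
rewrite iter_mulr_1 -rmorphXn /=.
under eq_bigr do rewrite big_mkcond /=.
rewrite bigA_distr_bigA /= /digit_average.
pose z := (\sum_(v : {ffun 'I_n -> 'I_N})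
    if [forall i : 'I_n, D i (v i)]
    then cos (- (2 * pi * lambda * digit_sum v)) else 0)
  +i* (\sum_(v : {ffun 'I_n -> 'I_N})
    if [forall i : 'I_n, D i (v i)]
    then sin (- (2 * pi * lambda * digit_sum v)) else 0).
rewrite (_ : \sum_(v : {ffun 'I_n -> 'I_N}) _ = z).
  by rewrite /z; simpc.
rewrite /z -sum_Complex; apply: eq_bigr => v _.
case: ifPn => [/forallP Dv|/forallPn[i /negbTE Dvi]]; last first.
  by rewrite (bigD1 i)//= Dvi mul0r.
rewrite -/(expi _) /digit_sum mulr_sumr -sumrN.
rewrite (eq_bigr (fun i : 'I_n =>
  expi (- (2 * pi * lambda * ((v i)%:R * rho ^+ i.+1))))); last first.
  move=> i _; rewrite Dv -expiMn; congr expi.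
  by rewrite -mulr_natr; ring.
by rewrite (big_morph expi expiD expi0).
Qed.

End partial_products.

Section fourier_of_digit_sets.
Context {R : realType} {d : measure_display} {T : measurableType d}
  {P : probability T R}.
Variables (N : nat) (rho : R) (mu : probability R R).
Variables (A : nat -> {RV P >-> nat}) (X : {RV P >-> R}).
Hypotheses (N0 : (0 < N)%N) (hrho : 0 < rho < N%:R^-1).
Hypotheses (indA : mutually_independent A)
  (unifA : forall j, uniform_digit N (A j)).
Hypothesis seriesX : {ae P, forall w,
  series (fun j => (A j w)%:R * rho ^+ j.+1) @ \oo --> X w}.
Hypothesis lawX : forall E : set R, measurable E -> mu E = distribution P X E.
Implicit Types (D : nat -> pred nat) (lambda : R).

Let rho0 : 0 < rho. Proof. by case/andP: hrho. Qed.

(** Dominated convergence on the space carrying the digits: almost surely the partial sums tend to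
    [X w] and the tests on the first [n] digits tend to the indicator of the digit set. *)
Lemma digit_average_cvg D (phi : R -> R) : continuous phi ->
  (forall x, `|phi x| <= 1) ->
  digit_average N rho D ^~ phi @ \oo -->
    \int[mu]_x (\1_(digit_set rho D) x * phi x).
Proof.
move=> cphi phi1; set E := digit_set rho D.
have mE : measurable E by exact: measurable_digit_set.
pose h x : R := \1_E x * phi x.
have mh : measurable_fun [set: R] h.
  apply: measurable_funM; first exact: measurable_indic.
  exact: continuous_measurable_fun.
have h1 x : `|h x| <= 1.
  rewrite normrM indicE; case: (_ \in _); rewrite ?normr1 ?normr0 ?mul0r//.
  by rewrite mul1r.
pose F n (v : {ffun 'I_n -> 'I_N}) : R :=
  if [forall i : 'I_n, D i (v i)] then phi (digit_sum rho v) else 0.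
have F1 n v : `|F n v| <= 1 by rewrite /F; case: ifP; rewrite ?normr0.
have intP : (\int[mu]_x (h x)%:E = \int[P]_w (h (X w))%:E)%E.
  transitivity (\int[distribution P X]_x (h x)%:E)%E.
    by apply: eq_measure_integral => B mB _; exact: lawX.
  rewrite integral_distribution//; first exact/measurable_EFinP.
  apply: (@probability_bounded_integrable _ _ _ _ _ 1) => [|w]; last exact: h1.
  exact: measurableT_comp mh _.
have /dominated_convergence : forall n,
    measurable_fun [set: T] (EFin \o digit_simple A (@F n)).
  by move=> n; apply/measurable_EFinP; exact: measurable_digit_simple.
move=> /(_ P measurableT (EFin \o (h \o X)) (cst 1%E)) [].
- by apply/measurable_EFinP; exact: measurableT_comp mh _.
- near=> w => _.
  have wN : forall j, (A j w < N)%N by near: w; exact: digit_lt_ae.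
  have wX : series (digit_term rho (A ^~ w)) @ \oo --> X w by near: w.
  have dX k := digit_iter_series N0 hrho k wN wX.
  apply: cvg_EFin; first by near=> n.
  rewrite (_ : _ \o _ = (fun n => (if [forall i : 'I_n, D i (A i w)] then 1 else 0)
     * phi (series (digit_term rho (A ^~ w)) n))); last first.
    apply/funext => n /=; rewrite (digit_simpleE _ wN) /F.
    under eq_forallb do rewrite ffunE /=.
    case: ifP; rewrite ?mul0r// mul1r => _; congr phi.
    rewrite /digit_sum seriesEord; apply: eq_bigr => i _.
    by rewrite ffunE.
  apply: cvgM; last exact: (cvg_comp _ _ wX (cphi _)).
  (* Inside the set every test succeeds; outside, some digit [k] fails and the test is 0 for all
     [n > k]. *)
  rewrite indicE; have [XE|XE] := boolP (X w \in E).
    rewrite (_ : (fun n => _) = cst 1); first exact: cvg_cst.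
    apply/funext => n; case: forallP => // nD; exfalso; apply: nD => i.
    by move: XE; rewrite inE => /(_ i); rewrite dX.
  move: XE; rewrite notin_setE => /existsNP[k]; rewrite dX => Dk.
  apply: cvg_near_cst; near=> n.
  case: forallP => // nD; exfalso; apply: Dk.
  have kn : (k < n)%N by near: n; exact: nbhs_infty_gt.
  exact: (nD (Ordinal kn)).
- apply: (@probability_bounded_integrable _ _ _ _ (cst 1) 1) => [|w].
    exact: measurable_cst.
  by rewrite normr1.
- near=> w => n _; have wN : forall j, (A j w < N)%N.
    by near: w; exact: digit_lt_ae.
  by rewrite /= (digit_simpleE _ wN) lee_fin.
move=> _ _; set I := (X in _ --> X) => cvgI.
have finI : I \is a fin_num.
  apply: integrable_fin_num => //.
  apply: (@probability_bounded_integrable _ _ _ _ _ 1) => [|w]; last exact: h1.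
  exact: measurableT_comp mh _.
rewrite /Rintegral intP -/I.
move: cvgI; rewrite -(fineK finI) => /fine_cvg; apply: cvg_trans.
apply: near_eq_cvg; near=> n.
by rewrite /= (integral_digit_simple indA unifA).
Unshelve. all: by end_near. Qed.

(** The infinite product formula for the transform of a digit set, expressed through squared moduli
    of finite products. *)
Lemma normc_fourier_cvg D lambda :
  (fun n => normc (partial_fourier N rho D n lambda) ^+ 2) @ \oo -->
    normc (fourier mu (fun x => (\1_(digit_set rho D) x)%:C) lambda) ^+ 2.
Proof.
have lin : continuous (fun x : R => - (2 * pi * lambda * x)).
  by move=> x; apply: cvgN; apply: cvgMr; exact: cvg_id.
rewrite sqr_normcE /fourier /cintegral /=.
rewrite (eq_Rintegral _ (g := fun x =>
    \1_(digit_set rho D) x * cos (- (2 * pi * lambda * x)))); last first.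
  by move=> x _ /=; rewrite mul0r subr0.
rewrite [X in _ + X ^+ 2](eq_Rintegral _ (g := fun x =>
    \1_(digit_set rho D) x * sin (- (2 * pi * lambda * x)))); last first.
  by move=> x _ /=; rewrite mul0r addr0.
under eq_cvg do rewrite partial_fourierE sqr_normcE /=.
apply: cvgD; rewrite expr2; under eq_cvg do rewrite expr2.
  by apply: cvgM; apply: digit_average_cvg => x; rewrite ?cos_max//;
    exact: (continuous_comp (lin x) (@continuous_cos _ _)).
by apply: cvgM; apply: digit_average_cvg => x; rewrite ?sin_max//;
  exact: (continuous_comp (lin x) (@continuous_sin _ _)).
Qed.

End fourier_of_digit_sets.

(** * Decay of the frame integral *)

(** The condition at [K] is overwritten; when [D K] is [predT] this amounts to imposing [p] in
    addition. *)
Definition restrict_digit (D : nat -> pred nat) (K : nat) (p : pred nat) :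
    nat -> pred nat :=
  fun k => if k == K then p else D k.

Section mask_modulus.
Context {R : realType}.
Variable n : nat.

(** [M(u)^2], with [M] the modulus of the mask of a uniform digit on {0,..,n-1}. *)
Definition sqmod (u : R) : R := normc (geo n (expi u)) ^+ 2 / n%:R ^+ 2.

Lemma sqmod_ge0 u : 0 <= sqmod u.
Proof. by rewrite /sqmod divr_ge0 ?sqr_ge0. Qed.

Lemma sqmod0 : (0 < n)%N -> sqmod 0 = 1.
Proof.
move=> n0; rewrite /sqmod expi0 /geo; under eq_bigr do rewrite expr1n.
rewrite sumr_const card_ord -[_ *+ _](rmorph_nat (real_complex R)) normc_real.
by rewrite normr_nat divff// expf_neq0// pnatr_eq0 -lt0n.
Qed.

Lemma continuous_sqmod : continuous sqmod.
Proof.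
have geoE u : geo n (expi u) =
    (\sum_(i < n) cos (u * i%:R)) +i* (\sum_(i < n) sin (u * i%:R)) :> R[i].
  rewrite -sum_Complex; apply: eq_bigr => i _.
  by rewrite -expiMn mulr_natr.
have -> : sqmod = fun u => ((\sum_(i < n) cos (u * i%:R)) ^+ 2 +
    (\sum_(i < n) sin (u * i%:R)) ^+ 2) / n%:R ^+ 2.
  by apply/funext => u; rewrite /sqmod geoE sqr_normcE.
have lin i : continuous (fun u : R => u * i%:R).
  by move=> u; apply: cvgMl; exact: cvg_id.
have cvg_sum (f : R -> R) : continuous f ->
    continuous (fun u : R => \sum_(i < n) f (u * i%:R)).
  move=> cf; elim: n => [|k IHk].
    by under eq_fun do rewrite big_ord0; move=> u; exact: cvg_cst.
  under eq_fun do rewrite big_ord_recr /=.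
  by move=> u; apply: cvgD; [exact: IHk|exact: (continuous_comp (lin k u) (cf _))].
move=> u; apply: cvgMl; apply: cvgD; rewrite expr2; under eq_cvg do rewrite expr2.
  by apply: cvgM; exact: (cvg_sum _ (@continuous_cos R)).
by apply: cvgM; exact: (cvg_sum _ (@continuous_sin R)).
Qed.

End mask_modulus.

Section frame_step.
Context {R : realType}.
Variables (N : nat) (rho : R) (mu : probability R R).
Hypothesis rho0 : 0 < rho.
Implicit Types (D : nat -> pred nat) (lambda : R).

Definition spectral D lambda : R :=
  normc (fourier mu (fun x => (\1_(digit_set rho D) x)%:C) lambda) ^+ 2.

Definition mass D : R := fine (mu (digit_set rho D)).

(** From here on the digits enter only through this product formula; no probability space
    appears. *)
Hypothesis spectral_cvg : forall D lambda,
  (fun n => normc (partial_fourier N rho D n lambda) ^+ 2) @ \oo -->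
    spectral D lambda.

Lemma spectral_ge0 D lambda : 0 <= spectral D lambda.
Proof. exact: sqr_ge0. Qed.

(** Once [n > K], the two partial products differ exactly by the factor [c], and this passes to the
    limit. *)
Lemma spectral_restrict D K p (c : R[i]) lambda :
  digit_mask N (D K) (- (2 * pi * lambda * rho ^+ K.+1)) =
    c * digit_mask N p (- (2 * pi * lambda * rho ^+ K.+1)) ->
  spectral D lambda = normc c ^+ 2 * spectral (restrict_digit D K p) lambda.
Proof.
move=> Dp; rewrite -(cvg_lim (@norm_hausdorff _ _) (@spectral_cvg D lambda)).
apply: (cvg_lim (@norm_hausdorff _ _)).
have := @spectral_cvg (restrict_digit D K p) lambda.
move=> /(cvgM (cvg_cst (normc c ^+ 2))); apply: cvg_trans; apply: near_eq_cvg.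
near=> n; have Kn : (K < n)%N by near: n; exact: nbhs_infty_gt.
rewrite /= -exprMn -ComplexField.Normc.normcM; congr (normc _ ^+ 2).
rewrite /partial_fourier (bigD1 (Ordinal Kn))//= [in RHS](bigD1 (Ordinal Kn))//=.
rewrite Dp /restrict_digit eqxx mulrA; congr (_ * _).
apply: eq_bigr => k; rewrite -val_eqE /= => /negbTE kK.
by rewrite kK.
Unshelve. all: by end_near. Qed.

Lemma massE D : mu (digit_set rho D) = (mass D)%:E.
Proof.
by rewrite fineK// fin_num_measure//; exact: measurable_digit_set.
Qed.

Lemma mass_ge0 D : 0 <= mass D.
Proof. exact: fine_ge0. Qed.

Lemma mass_le1 D : mass D <= 1.
Proof.
rewrite -lee_fin -massE; apply: probability_le1.
exact: measurable_digit_set.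
Qed.

Lemma sqnormL2_digit_set D :
  sqnormL2 mu (fun x => (\1_(digit_set rho D) x)%:C) = (mass D)%:E.
Proof.
rewrite /sqnormL2; under eq_integral => x _.
  rewrite normc_real ger0_norm// (_ : \1__ x ^+ 2 = \1_(digit_set rho D) x).
    over.
  by rewrite indicE; case: (_ \in _); rewrite ?expr1n ?expr0n.
rewrite integral_indic//; last exact: measurable_digit_set.
by rewrite setIT; exact: massE.
Qed.

Lemma in_L2_digit_set D : in_L2 mu (fun x => (\1_(digit_set rho D) x)%:C).
Proof.
split; last by rewrite sqnormL2_digit_set ltry.
split=> /=; last exact: measurable_cst.
by apply: measurable_indic; exact: measurable_digit_set.
Qed.

Lemma spectral0 D : spectral D 0 = mass D ^+ 2.
Proof.
rewrite /spectral sqr_normcE /fourier /cintegral /=.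
rewrite (eq_Rintegral _ (g := \1_(digit_set rho D))); last first.
  by move=> x _ /=; rewrite mulr0 mul0r oppr0 cos0 sin0 !mulr0 subr0 mulr1.
rewrite [X in _ + X ^+ 2](eq_Rintegral _ (g := cst 0)); last first.
  by move=> x _ /=; rewrite mulr0 mul0r oppr0 sin0 mulr0 mul0r addr0.
rewrite Rintegral_cst// mul0r expr0n addr0 /Rintegral.
by rewrite integral_indic//; [rewrite setIT|exact: measurable_digit_set].
Qed.

Lemma measurable_spectral D : measurable_fun [set: R] (spectral D).
Proof.
apply: (@measurable_fun_cvg _ _ _ _
  (fun n lambda => normc (partial_fourier N rho D n lambda) ^+ 2)); last first.
  by move=> lambda _; exact: spectral_cvg.
move=> n.
have lin a : continuous (fun lambda : R => - (2 * pi * lambda * a)).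
  by move=> lambda; apply: cvgN; apply: cvgMl; apply: cvgMr; exact: cvg_id.
have mavg (f : R -> R) : continuous f -> measurable_fun [set: R]
    (fun lambda => digit_average N rho D n (fun x => f (- (2 * pi * lambda * x)))).
  move=> cf; apply: measurable_funM => //; apply: measurable_sum => v.
  case: [forall i : 'I_n, D i (v i)] => //.
  apply: continuous_measurable_fun => lambda.
  exact: (continuous_comp (lin _ lambda) (cf _)).
rewrite (_ : (fun lambda => _) = (fun lambda =>
    digit_average N rho D n (fun x => cos (- (2 * pi * lambda * x))) ^+ 2 +
    digit_average N rho D n (fun x => sin (- (2 * pi * lambda * x))) ^+ 2)).
  by apply: measurable_funD; apply: measurable_funX; apply: mavg;
    [exact: continuous_cos|exact: continuous_sin].
by apply/funext => lambda; rewrite partial_fourierE sqr_normcE.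
Qed.

Section step.
Variables (g n b m : nat).
Hypotheses (rho1 : rho < 1) (m0 : (0 < m)%N) (Ngn : N = (g * n)%N)
  (n1 : (1 < n)%N) (b0 : (0 < b)%N) (cop : coprime n b) (hB : rho ^+ m * (g * b)%:R = 1).

Let n0 : (0 < n)%N. Proof. exact: ltnW. Qed.

Let nR0 : 0 < n%:R :> R. Proof. by rewrite ltr0n. Qed.

Let normc_coef (z : R[i]) :
  normc ((n%:R)%:C * ((n%:R^-1)%:C * geo n z)) ^+ 2 =
    n%:R ^+ 2 * (normc (geo n z) ^+ 2 / n%:R ^+ 2).
Proof.
rewrite !ComplexField.Normc.normcM !normc_real ger0_norm// ger0_norm ?invr_ge0//.
rewrite !exprMn exprVn; ring.
Qed.

Lemma spectral_restrict_lt D K lambda : D K = predT ->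
  spectral D lambda =
    n%:R ^+ 2 * sqmod n (- (2 * pi * lambda * rho ^+ K.+1) *+ g) *
    spectral (restrict_digit D K (fun a => (a < g)%N)) lambda.
Proof.
move=> DK; rewrite /sqmod expiMn -normc_coef; apply: spectral_restrict.
by rewrite DK; exact: (digit_mask_lt _ Ngn n0).
Qed.

Lemma spectral_restrict_dvd D K lambda : D K = predT ->
  spectral D lambda =
    n%:R ^+ 2 * sqmod n (- (2 * pi * lambda * rho ^+ K.+1)) *
    spectral (restrict_digit D K (fun a => n %| a)%N) lambda.
Proof.
move=> DK; rewrite /sqmod -normc_coef; apply: spectral_restrict.
by rewrite DK; exact: (digit_mask_dvd _ Ngn n0).
Qed.

(** The spectral identity read at [lambda = 0], where the density is the squared mass and the mask
    has modulus 1. *)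
Lemma mass_restrict_lt D K : D K = predT ->
  mass D = n%:R * mass (restrict_digit D K (fun a => (a < g)%N)).
Proof.
move=> DK; apply/eqP; rewrite -(eqrXn2 (n := 2))// ?mass_ge0 ?mulr_ge0 ?mass_ge0//.
rewrite exprMn -!spectral0 (spectral_restrict_lt _ DK).
by rewrite mulr0 mul0r oppr0 mul0rn sqmod0 ?mulr1.
Qed.

Variables (Gamma : {measure set R -> \bar R}) (A C : R).
Hypotheses (A0 : 0 < A) (AC : A <= C).
(** The frame inequalities enter through indicators of digit sets, whose squared norm is their
    mass. *)
Hypothesis frame : forall D,
  (A%:E * (mass D)%:E <= \int[Gamma]_lambda (spectral D lambda)%:E
     <= C%:E * (mass D)%:E)%E.

Definition energy D : R := fine (\int[Gamma]_lambda (spectral D lambda)%:E)%E.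

Let C0 : 0 < C. Proof. exact: lt_le_trans AC. Qed.

(** The upper frame bound makes the integral finite, so [fine] loses nothing. *)
Let energyE D : (\int[Gamma]_lambda (spectral D lambda)%:E = (energy D)%:E)%E.
Proof.
rewrite fineK// ge0_fin_numE; last first.
  by apply: integral_ge0 => lambda _; rewrite lee_fin spectral_ge0.
by have /andP[_ /le_lt_trans] := frame D; apply; rewrite -EFinM ltry.
Qed.

Lemma energy_ge D : A * mass D <= energy D.
Proof. by rewrite -lee_fin EFinM -energyE; have /andP[] := frame D. Qed.

Lemma energy_le D : energy D <= C * mass D.
Proof. by rewrite -lee_fin EFinM -energyE; have /andP[] := frame D. Qed.

Let ratio K lambda : R := sqmod n (- (2 * pi * lambda * rho ^+ K.+1) *+ g).

(** For fixed [lambda] the angle is a constant times [rho^i], so it tends to 0, where [sqmod] is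
    continuous with value 1. *)
Let ratio_cvg k0 lambda : (fun i => ratio (i + k0)%N lambda) @ \oo --> (1 : R).
Proof.
rewrite -(sqmod0 n0) /ratio.
apply: (@cvg_comp _ _ _ (fun i => - (2 * pi * lambda * rho ^+ (i + k0).+1) *+ g)
  (sqmod n) _ (nbhs (0 : R))); last exact: continuous_sqmod.
rewrite (_ : (fun i => _) =
    (fun i => - (2 * pi * lambda * rho ^+ k0.+1) *+ g * rho ^+ i)); last first.
  apply/funext => i; rewrite -addnS exprD mulNrn mulNrn mulNr [_ *+ g * _]mulrnAl.
  by rewrite [rho ^+ i * _]mulrC !mulrA. 
set c := _ *+ g; suff : (fun i => c * rho ^+ i) @ \oo --> c * 0 by rewrite mulr0.
apply: cvgM; first exact: cvg_cst.
by apply: cvg_expr; rewrite ger0_norm// ltW.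
Qed.

(* Let [M] be the modulus of the mask of the uniform digit on {0,..,n-1}, let
   [r = M u ^ 2] be the ratio at [K], and let [S], [S'], [S''] be the spectral
   densities for [D], for [D' i] and for [D'' i].  Then [S = n^2 r S'] and
   [S' = n^2 M(b u)^2 S'' <= n^2 L^2 r S''], so that
   [n^2 S' = (S + e n^2 S') / (r + e) <= S / (r + e) + e n^4 L^2 S''].
   The second term has small integral by the upper frame bound; as [K] grows
   [r] tends to 1 and dominated convergence handles the first. *)
Lemma energy_step D k0 : (forall k, (k0 <= k)%N -> D k = predT) -> 0 < mass D ->
  exists2 K, (k0 <= K)%N &
    n%:R ^+ 2 * energy (restrict_digit D K (fun a => (a < g)%N)) <=
      3 / 2 * energy D.
Proof.
move=> Dk0 mD0.
have [L L0 hL] := coprime_geo_bound (R := R) b0 cop.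
have E0 : 0 < energy D by apply: lt_le_trans (energy_ge D); rewrite mulr_gt0.
pose Q : R := n%:R ^+ 4 * L ^+ 2.
have Q0 : 0 < Q by rewrite /Q mulr_gt0// exprn_gt0.
(* Chosen so that [Q * e * C] is a quarter of the energy: since masses are at most 1, this caps the
   error term. *)
pose e : R := energy D / (4 * (Q * C)).
have e0 : 0 < e by rewrite /e divr_gt0// !mulr_gt0.
have QeE : Q * e * C = energy D / 4 by rewrite /e; field; rewrite !gt_eqF.
clearbody e.
pose h i lambda := spectral D lambda / (ratio (i + (m + k0))%N lambda + e).
have den0 K lambda : 0 < ratio K lambda + e by rewrite ltr_wpDl// sqmod_ge0.
(* With [J = i + k0], [D' i] cuts at position [J + m] and [D'' i] also at [J]; both positions are
   free in [D]. *)
pose D' i := restrict_digit D (i + (m + k0))%N (fun a => (a < g)%N).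
pose D'' i := restrict_digit (D' i) (i + k0)%N (fun a => n %| a)%N.
have bound i lambda : n%:R ^+ 2 * spectral (D' i) lambda <=
    Q * e * spectral (D'' i) lambda + h i lambda.
  have DK : D (i + (m + k0))%N = predT by apply: Dk0; rewrite addnA leq_addl.
  have D'J : D' i (i + k0)%N = predT.
    rewrite /D' /restrict_digit addnCA -[X in X == _]add0n eqn_add2r.
    by rewrite eq_sym (gtn_eqF m0) Dk0 ?leq_addl.
  set r := ratio (i + (m + k0))%N lambda.
  set s1 := spectral (D' i) lambda; set s2 := spectral (D'' i) lambda.
  have s1_ge0 : 0 <= s1 by exact: spectral_ge0.
  have s2_ge0 : 0 <= s2 by exact: spectral_ge0.
  have r_ge0 : 0 <= r by exact: sqmod_ge0.
  have SE : spectral D lambda = n%:R ^+ 2 * r * s1 by exact: spectral_restrict_lt.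
  have s12 : s1 <= n%:R ^+ 2 * (L ^+ 2 * r) * s2.
    rewrite {1}/s1 (spectral_restrict_dvd _ D'J) -/(D'' i) -/s2.
    rewrite ler_wpM2r// ler_wpM2l ?sqr_ge0// /r /ratio /sqmod mulrA.
    rewrite ler_wpM2r ?invr_ge0 ?sqr_ge0// -exprMn.
    (* Since [rho^m g b = 1], the angle at position [J] is [b] times [u], the angle at [J + m]
       multiplied by [g]. Coprimality then compares the two masks. *)
    set u := _ *+ g; have -> : - (2 * pi * lambda * rho ^+ (i + k0).+1) = u *+ b.
      rewrite /u -mulrnA -[_ *+ (g * b)]mulr_natr.
      rewrite (_ : (i + (m + k0)).+1 = ((i + k0).+1 + m)%N); last first.
        by rewrite addSn -addnA [(k0 + m)%N]addnC.
      rewrite exprD.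
      by rewrite [_ * (_ * rho ^+ m)]mulrA mulNr -[_ * rho ^+ m * _]mulrA hB mulr1.
    rewrite expiMn lerXn2r ?nnegrE ?normc_ge0//.
      by rewrite mulr_ge0 ?normc_ge0// ltW.
    by apply: hL; exact: normc_expi.
  rewrite /h -/r SE -lerBlDr; set M := n%:R ^+ 2 in s12 *.
  have re0 : 0 < r + e by exact: den0.
  have -> : M * s1 - M * r * s1 / (r + e) = e * (M * s1) / (r + e).
    by field; rewrite gt_eqF.
  have M0 : 0 < M by rewrite exprn_gt0.
  (* After clearing [r + e], the bound on [s1] accounts for the part with [r]; the remaining surplus
     is [Q e^2 s2 >= 0]. *)
  rewrite ler_pdivrMr// /Q -[4%N]/(2 * 2)%N exprM -/M.
  have : M * s1 <= M ^+ 2 * L ^+ 2 * (r * s2).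
    by rewrite (le_trans (ler_wpM2l (ltW M0) s12))//; lra.
  move=> /(ler_wpM2l (ltW e0)) /le_trans; apply.
  rewrite -subr_ge0 (_ : _ - _ = M ^+ 2 * L ^+ 2 * e * s2 * e); last by ring.
  by do ![done|exact: sqr_ge0|exact: (ltW e0)|apply: mulr_ge0].
have hE i lambda : 0 <= h i lambda.
  by rewrite divr_ge0 ?spectral_ge0// ltW.
have mh i : measurable_fun [set: R] (h i).
  apply: measurable_funM; first exact: measurable_spectral.
  apply: continuous_measurable_fun => lambda; apply: cvgV.
    by rewrite gt_eqF.
  apply: cvgD; last exact: cvg_cst.
  apply: (@continuous_comp _ _ _
    (fun x => - (2 * pi * x * rho ^+ (i + (m + k0)).+1) *+ g) (sqmod n)).
    by apply: cvgMn; apply: cvgN; apply: cvgMl; apply: cvgMr; exact: cvg_id.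
  exact: continuous_sqmod.
pose h0 lambda := spectral D lambda / (1 + e).
have e1 : 0 < 1 + e by rewrite addr_gt0.
have mspec c : measurable_fun [set: R] (fun lambda => (spectral D lambda / c)%:E).
  by apply/measurable_EFinP; apply: measurable_funM => //; exact: measurable_spectral.
(* The dominating function is [spectral D / e], integrable because the energy is finite; the [e] in
   the denominator is what bounds [h] near zeros of the mask. *)
have hcvg : (fun i => \int[Gamma]_lambda (h i lambda)%:E)%E @ \oo -->
    (\int[Gamma]_lambda (h0 lambda)%:E)%E.
  have := @dominated_convergence _ _ _ Gamma setT measurableT
    (fun i => EFin \o h i) (EFin \o h0) (fun lambda => (spectral D lambda / e)%:E).
  case=> //.
  - by move=> i; apply/measurable_EFinP.
  - exact: mspec.
  - apply: aeW => lambda _; apply: cvg_EFin; first by apply: nearW.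
    apply: cvgM; first exact: cvg_cst.
    apply: cvgV; first by rewrite gt_eqF.
    by apply: cvgD; [exact: ratio_cvg|exact: cvg_cst].
  - apply/integrableP; split; first exact: mspec.
    rewrite (eq_integral (fun lambda => e^-1%:E * (spectral D lambda)%:E)%E).
      rewrite ge0_integralZl//.
      + by rewrite energyE -EFinM ltry.
      + by apply/measurable_EFinP; exact: measurable_spectral.
      + by move=> lambda _; rewrite lee_fin spectral_ge0.
      + by rewrite lee_fin invr_ge0 ltW.
    move=> lambda _; rewrite /= ger0_norm ?divr_ge0 ?spectral_ge0// 1?ltW//.
    by rewrite EFinM muleC.
  - apply: aeW => lambda i _ /=; rewrite lee_fin ger0_norm//.
    rewrite ler_wpM2l ?spectral_ge0// lef_pV2 ?posrE//.
    by rewrite lerDr sqmod_ge0.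
have h0E : (\int[Gamma]_lambda (h0 lambda)%:E <= (energy D)%:E)%E.
  rewrite -energyE; apply: ge0_le_integral => //.
  - by move=> lambda _; rewrite lee_fin divr_ge0 ?spectral_ge0// ltW.
  - exact: mspec.
  - by apply/measurable_EFinP; exact: measurable_spectral.
  - move=> lambda _; rewrite lee_fin ler_pdivrMr// ler_peMr ?spectral_ge0//.
    by rewrite lerDl ltW.
have {}bound i : ((n%:R ^+ 2 * energy (D' i))%:E <=
    (energy D / 4)%:E + \int[Gamma]_lambda (h i lambda)%:E)%E.
  have mS F : measurable_fun [set: R] (fun lambda => (spectral F lambda)%:E).
    by apply/measurable_EFinP; exact: measurable_spectral.
  have int_ge0 F : forall lambda, [set: R] lambda -> (0 <= (spectral F lambda)%:E)%E.
    by move=> lambda _; rewrite lee_fin spectral_ge0.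
  have Qe0 : 0 <= Q * e by rewrite ltW// mulr_gt0.
  rewrite EFinM -energyE -ge0_integralZl ?lee_fin ?sqr_ge0//; last exact: int_ge0.
  apply: (@le_trans _ _ (\int[Gamma]_lambda
      ((Q * e)%:E * (spectral (D'' i) lambda)%:E + (h i lambda)%:E))%E).
    apply: ge0_le_integral => //.
    - by move=> lambda _; rewrite -EFinM lee_fin mulr_ge0 ?spectral_ge0 ?sqr_ge0.
    - exact: measurable_funeM.
    - apply: emeasurable_funD; first exact: measurable_funeM.
      by apply/measurable_EFinP.
    - by move=> lambda _; rewrite -!EFinM -EFinD lee_fin.
  rewrite ge0_integralD//.
  - rewrite ge0_integralZl//; last exact: int_ge0.
    rewrite energyE -EFinM; apply: leeD => //; rewrite lee_fin -QeE.
    rewrite ler_wpM2l//; apply: le_trans (energy_le _) _.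
    by rewrite ler_piMr ?mass_le1// ltW.
  - by move=> lambda _; rewrite -EFinM lee_fin mulr_ge0 ?spectral_ge0.
  - exact: measurable_funeM.
  - by move=> lambda _; rewrite lee_fin.
  - by apply/measurable_EFinP.
(* If every [K] failed, each integral of [h i] would be at least [3/2 - 1/4 = 5/4] of the energy,
   while their limit is at most the energy. *)
apply: contrapT => noK.
have hlow i : ((5 / 4 * energy D)%:E <= \int[Gamma]_lambda (h i lambda)%:E)%E.
  have E32 : 3 / 2 * energy D < n%:R ^+ 2 * energy (D' i).
    rewrite ltNge; apply/negP => small; apply: noK.
    by exists (i + (m + k0))%N; rewrite // addnA leq_addl.
  have E54 : (5 / 4 * energy D)%:E =
      ((3 / 2 * energy D)%:E - (energy D / 4)%:E)%E :> \bar R.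
    by rewrite -EFinB; congr EFin; field.
  rewrite E54 leeBlDl//; apply: le_trans (bound i); rewrite lee_fin; exact: ltW.
have : ((5 / 4 * energy D)%:E <= (energy D)%:E)%E.
  apply: le_trans h0E; apply: (cvge_to_ge hcvg); exact: nearW.
by rewrite lee_fin; lra.
Qed.

(** Only finitely many positions are constrained at each stage, so [energy_step] applies again. One
    step divides the mass by [n] and multiplies the energy by at most [3 / (2 n^2)]. *)
Lemma energy_decay r : exists D,
  [/\ (exists k0, forall k, (k0 <= k)%N -> D k = predT),
  0 < mass D & energy D <= C * (3 / 4) ^+ r * mass D].
Proof.
elim: r => [|r [D [[k0 Dk0] D0 IHD]]].
  exists (fun=> predT); have massT : mass (fun=> predT) = 1.
    rewrite /mass (_ : digit_set _ _ = setT) ?probability_setT//.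
    by apply/seteqP; split.
  split; [by exists 0%N|by rewrite massT|].
  by rewrite expr0 mulr1; exact: energy_le.
have [K k0K step] := energy_step Dk0 D0.
have DK : D K = predT by exact: Dk0.
have massD := mass_restrict_lt DK.
set D' := restrict_digit _ _ _ in step massD.
exists D'; split.
- exists K.+1 => k Kk; rewrite /D' /restrict_digit gtn_eqF//.
  by rewrite Dk0// (leq_trans k0K)// ltnW.
- by move: D0; rewrite massD pmulr_rgt0.
have le1 : n%:R ^+ 2 * energy D' <= 3 / 2 * (C * (3 / 4) ^+ r * (n%:R * mass D')).
  by apply: (le_trans step); rewrite ler_wpM2l ?divr_ge0// -massD.
(* The quotient changes by at most [3 / (2 n)], which is at most [3/4] because [n >= 2]. *)
have n2 : 3 / 2 <= 3 / 4 * n%:R :> R.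
  rewrite (_ : 3 / 2 = 3 / 4 * 2); last by field.
  by rewrite ler_wpM2l ?divr_ge0// ler_nat.
have X0 : 0 <= C * (3 / 4) ^+ r * mass D'.
  by rewrite !mulr_ge0 ?exprn_ge0 ?mass_ge0 ?divr_ge0// ltW.
rewrite -(ler_pM2l nR0) -(ler_pM2l nR0) mulrA -expr2 (le_trans le1)//.
rewrite exprS; set X := C * _ * _ in X0 *.
have -> : 3 / 2 * (C * (3 / 4) ^+ r * (n%:R * mass D')) = 3 / 2 * n%:R * X.
  by rewrite /X; ring.
have -> : n%:R * (n%:R * (C * (3 / 4 * (3 / 4) ^+ r) * mass D')) =
    3 / 4 * n%:R * n%:R * X by rewrite /X; ring.
by apply: ler_wpM2r => //; exact: ler_wpM2r.
Qed.

(** Comparing [energy_decay] with the lower frame bound gives [A <= C (3/4)^r] for every [r]. *)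
Lemma frame_contradiction : False.
Proof.
have : (fun r => C * (3 / 4) ^+ r) @ \oo --> C * 0.
  apply: cvgM; first exact: cvg_cst.
  by apply: cvg_expr; rewrite ger0_norm; lra.
rewrite mulr0 => cvg0.
suff : A <= 0 by rewrite leNgt A0.
apply: (cvgr_to_ge cvg0); apply: nearW => r.
have [D [_ D0 leD]] := energy_decay r.
by rewrite -(ler_pM2r D0); exact: le_trans (energy_ge D) leD.
Qed.

End step.

End frame_step.

(** * Reduction to the coprime quotients of [N] and [B] *)

Theorem theorem1p1 (R : realType) (N : nat) (rho : R) (m B : nat)
    (mu : probability R R)
    (hN : (2 <= N)%N) (hrho : 0 < rho < N%:R^-1)
    (hm : (1 <= m)%N) (hB : (2 <= B)%N) (hmB : rho ^- m = B%:R)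
    (hNB : ~~ (N %| B)%N)
    (hmu : is_bernoulli_convolution N rho mu) :
  ~ admits_frame_measure mu.
Proof.
move=> [Gamma [A [C [A0 AC frame]]]].
have [d [T [P [X_ [X [indX unifX serX lawX]]]]]] := hmu.
have N0 : (0 < N)%N by exact: ltnW.
have B0 : (0 < B)%N by exact: ltnW.
have /andP[rho0 rhoN] := hrho.
set g := gcdn N B.
have g0 : (0 < g)%N by rewrite gcdn_gt0 N0.
have Ngn : N = (g * (N %/ g))%N by rewrite mulnC divnK// dvdn_gcdl.
have Bgb : B = (g * (B %/ g))%N by rewrite mulnC divnK// dvdn_gcdr.
(* If [N / g] were 1, then [N = g] would divide [B]. *)
have n1 : (1 < N %/ g)%N.
  rewrite ltn_neqAle eq_sym divn_gt0// dvdn_leq ?dvdn_gcdl// andbT.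
  apply: contra hNB => /eqP n1; rewrite Ngn n1 muln1; exact: dvdn_gcdr.
have b0 : (0 < B %/ g)%N by rewrite divn_gt0// dvdn_leq ?dvdn_gcdr.
have cop : coprime (N %/ g) (B %/ g).
  by rewrite /coprime -(eqn_pmul2l g0) muln_gcdr -Ngn -Bgb muln1.
have rho1 : rho < 1.
  by apply: lt_le_trans rhoN _; rewrite invf_le1 ?ltr0n// ler1n.
have rhoB : rho ^+ m * (g * (B %/ g))%:R = 1.
  by rewrite -Bgb -hmB mulfV// expf_neq0// gt_eqF.
apply: (@frame_contradiction R N rho mu rho0 _ g (N %/ g) (B %/ g) m rho1 hm
  Ngn n1 b0 cop rhoB Gamma A C A0 AC).
  by move=> D lambda; exact: (normc_fourier_cvg N0 hrho indX unifX serX lawX).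
move=> D; rewrite -(sqnormL2_digit_set mu rho0).
by apply: frame; exact: in_L2_digit_set.
Qed.
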